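(* Let $r$ be a positive real number. For a positive integer $N$ (with $N_0\ge1$), let $a_1,\dots,a_N$ be the modified Ganelius sampling points with parameter $r$. Then there is a positive number $C$, independent of $N$, such that for all such $N$ $$\max_{s\in[0,1]} s^{r}\prod_{k=1}^{N}\left|\frac{s-a_k}{s+a_k}\right|\le C\exp\left(-\pi\sqrt{Nr}\right).$$
   Context: **Modified Ganelius sampling points with parameter $r>0$.** For a positive integer $N$ put $N_0=N-\lceil \frac{\pi}{4}\sqrt{Nr}\rceil$ and $\varphi(x)=\exp(\pi\sqrt{x/r})$ for $x\ge0$. The points are defined when $N_0\ge1$ by: $a_k=\varphi(k-1)/\varphi(N_0)$ for $k=1,\dots,N_0$; $a_{N_0+1}=\varphi(N_0-1/2)/\varphi(N_0)$; and $a_k=1-\frac{k-N_0-1}{5(N-N_0-1)}$ for $k=N_0+2,\dots,N$. *)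

(* Defs.v *)
From mathcomp Require Import all_boot all_order all_algebra.
From mathcomp Require Import all_classical all_reals all_analysis.

Set Implicit Arguments.
Unset Strict Implicit.
Unset Printing Implicit Defensive.

Import Order.TTheory GRing.Theory Num.Theory.

Local Open Scope classical_set_scope.
Local Open Scope ring_scope.

(* N_0.  The ceiling is nonnegative, so its absolute value is itself; the
   subtraction is truncated, which is harmless because the points are used
   only when N_0 >= 1. *)
Definition ganelius_N0 (R : realType) (r : R) (N : nat) : nat :=
  (N - `|Num.ceil (pi / 4 * Num.sqrt (N%:R * r))|)%N.

Definition ganelius_phi (R : realType) (r x : R) : R :=
  expR (pi * Num.sqrt (x / r)).

(* The k-th point, meaningful for 1 <= k <= N. *)
Definition ganelius_point (R : realType) (r : R) (N k : nat) : R :=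
  let N0 := ganelius_N0 r N in
  if (k <= N0)%N then ganelius_phi r (k%:R - 1) / ganelius_phi r N0%:R
  else if k == N0.+1 then ganelius_phi r (N0%:R - 1 / 2) / ganelius_phi r N0%:R
  else 1 - (k%:R - N0%:R - 1) / (5 * (N%:R - N0%:R - 1)).

(* [0 `^ r = 0] in the library when [r != 0], so s = 0 needs no special case. *)
Definition ganelius_weighted_product (R : realType) (r : R) (N : nat) (s : R) : R :=
  s `^ r * \prod_(1 <= k < N.+1)
             `|(s - ganelius_point r N k) / (s + ganelius_point r N k)|.

Definition is_maximum (R : realType) (E : set R) (m : R) : Prop :=
  E m /\ ubound E m.

(* Main.v *)
Require Import Defs.
From mathcomp Require Import all_boot all_order all_algebra.
From mathcomp Require Import all_classical all_reals all_analysis.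
From mathcomp Require Import ring lra zify.

(* Put [c = pi / sqrt r], [T = c sqrt q] with [q = N_0], and write [s = exp(t - T)].
   The first [N_0 + 1] points are [exp(c sqrt x - T)] for [x = 0, .., q - 1, q - 1/2],
   so the logarithm of their product is [sum_x log tanh(|c sqrt x - t| / 2)], which
   is compared with the integral over [x] in [[0, q]].  Expanding
   [log tanh(u / 2) = - 2 sum_(w odd) exp(- w u) / w] reduces this to a trapezoidal
   rule for each exponential; the interval containing the peak costs
   [min(w D, 4 / (w D))] ([D] the local spacing), which is summable against [1 / w]
   uniformly in [D].  Since [sum_(w odd) 1 / w^2 = pi^2 / 8], the whole-line part of
   the integral contributes [- r t], cancelling the growth of [s^r = exp(r t - r T)];
   the truncation at [q] leaves a deficit [(4 r T / pi^2) sum_(w odd) s^w / w^2].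
   Each of the [~ (pi / 4) sqrt (N r)] points in [[4/5, 1]] has a factor at most
   [exp(- (16 / pi^2) sum_(w odd) s^w / w^2)], which is just enough to absorb it.
   The odd series are truncated at [J = 2^q] terms, so that only finite sums occur. *)

Import Order.TTheory GRing.Theory Num.Theory.
Import numFieldNormedType.Exports.

Local Open Scope classical_set_scope.
Local Open Scope ring_scope.

Set Implicit Arguments.
Unset Strict Implicit.
Unset Printing Implicit Defensive.

(** * Calculus inequalities for exponentials, by the sign of a derivative *)

Lemma ge0_is_derive_le (R : realType) (f df : R -> R) (a b : R) : a <= b ->
  (forall x, a <= x <= b -> is_derive x 1 f (df x)) ->
  (forall x, a <= x <= b -> 0 <= df x) -> f a <= f b.
Proof.
move=> ab fdf df_ge0.
have [||c cab] := @MVT_segment R f df a b ab.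
- by move=> x /[!in_itv]/= /andP[/ltW ? /ltW ?]; apply: fdf; apply/andP.
- apply: derivable_within_continuous => x /[!in_itv]/= xab.
  by have := fdf _ xab; case.
rewrite -subr_ge0 => ->; apply: mulr_ge0; last by rewrite subr_ge0.
by apply: df_ge0; rewrite in_itv/= in cab.
Qed.

(** The left side is the integral of [exp(sqrt u)] over [a^2, b^2]; the integrand is at most its
    value at the right end. This crude bound serves in the cell of the peak, where [a] may lie below
    the range of convexity. *)
Lemma rising_antiderivative_le (R : realType) (a b : R) : 0 <= a -> a <= b ->
  2 * (expR b * (b - 1) - expR a * (a - 1)) <= (b ^+ 2 - a ^+ 2) * expR b.
Proof.
move=> a0 ab.
pose f (x : R) := (x ^+ 2 - a ^+ 2) * expR x - 2 * (expR x * (x - 1)).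
suff : f a <= f b by rewrite /f; lra.
apply: (@ge0_is_derive_le _ _ (fun x => (x ^+ 2 - a ^+ 2) * expR x)) => // x xab.
  rewrite /f; apply: is_derive_eq.
  by rewrite /GRing.scale/=; ring.
by apply: mulr_ge0; [nra|exact: expR_ge0].
Qed.

Lemma one_add_mul_expRN_ge (R : realType) (y : R) : 0 <= y ->
  1 - y ^+ 2 / 2 <= (1 + y) * expR (- y).
Proof.
move=> y0; pose f (x : R) := (1 + x) * expR (- x) + x ^+ 2 / 2.
suff : f 0 <= f y by rewrite /f oppr0 expR0; lra.
apply: (@ge0_is_derive_le _ _ (fun x => x * (1 - expR (- x)))) => // x xy.
  by rewrite /f; apply: is_derive_eq; rewrite /GRing.scale/=; field.
by apply: mulr_ge0; [lra|rewrite subr_ge0 expR_le1; lra].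
Qed.

(* For [1 <= a] the function [u |-> exp(sqrt u)] is convex on [a^2, b^2]; this is
   its trapezoidal rule, and [falling_trapezoid_le] that of [exp(- sqrt u)]. *)
Lemma rising_trapezoid_le (R : realType) (a b : R) : 1 <= a -> a <= b ->
  2 * (expR b * (b - 1) - expR a * (a - 1)) <=
  2^-1 * (b ^+ 2 - a ^+ 2) * (expR a + expR b).
Proof.
move=> a1 ab.
pose f (x : R) := 2^-1 * (x ^+ 2 - a ^+ 2) * (expR a + expR x)
  - 2 * (expR x * (x - 1)).
suff : f a <= f b by rewrite /f; lra.
apply: (@ge0_is_derive_le _ _
  (fun x => x * (expR a - expR x) + 2^-1 * (x ^+ 2 - a ^+ 2) * expR x)) => // x xab.
  by rewrite /f; apply: is_derive_eq; rewrite /GRing.scale/=; field.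
have := @one_add_mul_expRN_ge R (x - a) ltac:(lra).
rewrite (_ : - (x - a) = a - x); last by ring.
set e := expR (a - x) => He.
have -> : expR a = expR x * e by rewrite /e -expRD; congr expR; ring.
rewrite [leRHS](_ : _ = expR x * (x * e - x + 2^-1 * (x ^+ 2 - a ^+ 2))); last by ring.
have e0 : 0 < e by exact: expR_gt0.
apply: mulr_ge0; first exact: expR_ge0.
(* Multiplying by the positive number 1 + (x - a) lets the lower bound [He] replace [e]; what
   remains is exactly (x - a)^2 (a - 1) / 2, and this is where [1 <= a] enters. *)
have : 0 <= (x * e - x + 2^-1 * (x ^+ 2 - a ^+ 2)) * (1 + (x - a)).
  have : 0 <= x * ((1 + (x - a)) * e - (1 - (x - a) ^+ 2 / 2)) by apply: mulr_ge0; lra.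
  have : 0 <= (x - a) ^+ 2 * (a - 1) by apply: mulr_ge0; [exact: sqr_ge0|lra].
  nra.
by rewrite pmulr_lge0 //; lra.
Qed.

Lemma falling_trapezoid_le (R : realType) (a b : R) : 0 <= a -> a <= b ->
  2 * (expR (- a) * (a + 1) - expR (- b) * (b + 1)) <=
  2^-1 * (b ^+ 2 - a ^+ 2) * (expR (- a) + expR (- b)).
Proof.
move=> a0 ab.
pose f (x : R) := 2^-1 * (x ^+ 2 - a ^+ 2) * (expR (- a) + expR (- x))
  + 2 * (expR (- x) * (x + 1)).
suff : f a <= f b by rewrite /f; lra.
apply: (@ge0_is_derive_le _ _ (fun x => x * (expR (- a) - expR (- x))
   - 2^-1 * (x ^+ 2 - a ^+ 2) * expR (- x))) => // x xab.
  by rewrite /f; apply: is_derive_eq; rewrite /GRing.scale/=; field.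
have -> : expR (- a) = expR (- x) * expR (x - a) by rewrite -expRD; congr expR; ring.
have := expR_ge1Dx (x - a); set e := expR (x - a) => He.
rewrite [leRHS](_ : _ = expR (- x) *
  (x * e - x - 2^-1 * (x ^+ 2 - a ^+ 2))); last by ring.
apply: mulr_ge0; first exact: expR_ge0.
have : 0 <= x * (e - (1 + (x - a))) by apply: mulr_ge0; lra.
nra.
Qed.

(** * Truncations of the series of artanh *)

(** For [p = 1] a partial sum of artanh z; for [p = 2] one of the Legendre chi function of order 2,
    whose value at 1 is pi^2 / 8. *)
Definition odd_series (R : realType) (p J : nat) (z : R) : R :=
  \sum_(j < J) z ^+ (2 * j).+1 / (2 * j).+1%:R ^+ p.

Lemma sum_even_powers (R : realType) (J : nat) (z : R) :
  (1 - z ^+ 2) * (\sum_(j < J) z ^+ (2 * j)) = 1 - z ^+ (2 * J).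
Proof.
elim: J => [|J IH]; first by rewrite big_ord0 muln0 expr0; ring.
by rewrite big_ord_recr/= mulrDr IH (_ : 2 * J.+1 = (2 * J).+2)%N ?mulnS// !exprS; ring.
Qed.

(** For z < 1, ln((1 + z) / (1 - z)) minus twice the partial sum vanishes at 0 and has derivative 2
    z^(2J) / (1 - z^2). The form without logarithm or quotient also covers z = 1. *)
Lemma one_sub_le_odd_series (R : realType) (J : nat) (z : R) : 0 <= z <= 1 ->
  1 - z <= (1 + z) * expR (- (2 * odd_series 1 J z)).
Proof.
move=> /andP[z0]; rewrite le_eqVlt => /predU1P[->|z1].
  by rewrite subrr; apply: mulr_ge0; [lra|exact: expR_ge0].
pose f (x : R) := ln (1 + x) - ln (1 - x) - 2 * odd_series 1 J x.
have f0 : f 0 = 0.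
  rewrite /f addr0 subr0 ln1 /odd_series big1 ?mulr0 ?subr0//.
  by move=> i _; rewrite expr0n/= mul0r.
have : f 0 <= f z.
  apply: (@ge0_is_derive_le _ _ (fun x => (1 + x)^-1 + (1 - x)^-1
    - 2 * \sum_(j < J) x ^+ (2 * j))) => // x /andP[x0 xz].
    have p1 : 0 < 1 + x by lra.
    have p2 : 0 < 1 - x by lra.
    have dl1 : is_derive (1 + x) 1 (@ln R) (1 + x)^-1 by exact: is_derive1_ln.
    have dl2 : is_derive (1 - x) 1 (@ln R) (1 - x)^-1 by exact: is_derive1_ln.
    have dS : is_derive x 1 (odd_series 1 J) (\sum_(j < J) x ^+ (2 * j)).
      rewrite (_ : odd_series 1 J =
        \sum_(j < J) ((2 * j).+1%:R^-1 *: (@idfun R ^+ (2 * j).+1))); last first.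
        apply/funext => y; rewrite fct_sumE; apply: eq_bigr => i _.
        by rewrite expr1 mulrC exprfctE.
      apply: is_derive_sum => i; apply: is_derive_eq.
      by rewrite /GRing.scale/= mulr1 mulrA mulVf ?pnatr_eq0// mul1r.
    rewrite /f; apply: is_derive_eq; rewrite /GRing.scale/=; ring.
  have h : 0 < 1 - x ^+ 2 by nra.
  rewrite [leRHS](_ : _ = 2 * (1 - (1 - x ^+ 2) * \sum_(j < J) x ^+ (2 * j)) / (1 - x ^+ 2)).
    rewrite sum_even_powers; apply: divr_ge0; last exact: ltW.
    by apply: mulr_ge0 => //; rewrite opprB addrC subrK exprn_ge0.
  by field; apply/and3P; split; apply/eqP; nra.
rewrite f0 /f => h.
have p1 : 0 < 1 + z by lra.
have p2 : 0 < 1 - z by lra.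
have -> : 1 - z = expR (ln (1 - z)) by rewrite lnK.
have -> : 1 + z = expR (ln (1 + z)) by rewrite lnK.
by rewrite -expRD ler_expR; lra.
Qed.

(** * Finite form of the Basel sum *)

Lemma sin_le_id (R : realType) (y : R) : 0 <= y -> sin y <= y.
Proof.
move=> y0; pose f (x : R) := x - sin x.
suff : f 0 <= f y by rewrite /f sin0; lra.
apply: (@ge0_is_derive_le _ _ (fun x => 1 - cos x)) => // x _; by rewrite subr_ge0 cos_le1.
Qed.

Lemma mul_cos_le_sin (R : realType) (y : R) : 0 <= y <= pi / 2 ->
  y * cos y <= sin y.
Proof.
move=> /andP[y0 ypi]; pose f (x : R) := sin x - x * cos x.
suff : f 0 <= f y by rewrite /f sin0; lra.
apply: (@ge0_is_derive_le _ _ (fun x => x * sin x)) => // x /andP[x0 xy].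
  by rewrite /f; apply: is_derive_eq; rewrite /GRing.scale/=; ring.
apply: mulr_ge0 => //; apply: sin_ge0_pi; rewrite x0/=.
by have := pi_ge0 R; lra.
Qed.

(** From sin y <= y <= tan y, with 1 / sin^2 = 1 + cot^2. *)
Lemma inv_sin2_bounds (R : realType) (y : R) : 0 < y < pi / 2 ->
  y ^- 2 <= sin y ^- 2 <= 1 + y ^- 2.
Proof.
move=> /andP[y0 ypi].
have s0 : 0 < sin y by apply: sin_gt0_pihalf; rewrite y0.
have c0 : 0 < cos y by apply: cos_gt0_pihalf; rewrite ypi andbT; have := pi_ge0 R; lra.
have s1 := sin_le_id (ltW y0).
have s2 : y * cos y <= sin y by apply: mul_cos_le_sin; rewrite !ltW.
apply/andP; split.
  by rewrite lef_pV2 ?posrE ?exprn_gt0// ler_sqr ?nnegrE// ltW.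
have -> : sin y ^- 2 = 1 + (cos y / sin y) ^+ 2.
  by rewrite -[LHS]mul1r -{1}(cos2Dsin2 y); field; rewrite gt_eqF.
rewrite lerD2l -exprVn ler_sqr ?nnegrE ?divr_ge0 ?invr_ge0 ?(ltW s0) ?(ltW c0) ?(ltW y0)//.
by rewrite ler_pdivrMr// mulrC ler_pdivlMr// mulrC.
Qed.

(** The angles y and pi/2 - y at level n + 1 satisfy 1 / sin^2 y + 1 / cos^2 y = 4 / sin^2(2y), and
    2y runs through the angles of level n; each level thus multiplies the sum by 4. *)
Lemma sum_inv_sin2 (R : realType) (n : nat) :
  \sum_(k < 2 ^ n) sin ((2 * k).+1%:R * (pi / 2 ^+ n.+2)) ^- 2 = 2 * 4 ^+ n :> R.
Proof.
have sin_half (y : R) : 0 < y < pi / 2 ->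
    sin y ^- 2 + sin (pi / 2 - y) ^- 2 = 4 * sin (y *+ 2) ^- 2.
  move=> /andP[y0 ypi].
  have s0 : 0 < sin y by apply: sin_gt0_pihalf; rewrite y0.
  have c0 : 0 < cos y by apply: cos_gt0_pihalf; rewrite ypi andbT; have := pi_ge0 R; lra.
  have -> : sin (pi / 2 - y) = cos y by rewrite addrC sinDpihalf cosN.
  rewrite sin_mulr2n.
  have -> : sin y ^- 2 + cos y ^- 2 = (cos y ^+ 2 + sin y ^+ 2) / (cos y ^+ 2 * sin y ^+ 2).
    by field; rewrite !gt_eqF.
  by rewrite cos2Dsin2; field; rewrite !gt_eqF.
have pi0 := @pi_gt0 R.
elim: n => [|n IH].
  rewrite expn0 big_ord1 muln0 mul1r expr0 mulr1.
  have : (sin (pi / 4 : R) ^- 2 + sin (pi / 2 - pi / 4) ^- 2 = 4 * sin (pi / 4 *+ 2) ^- 2).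
    by apply: sin_half; apply/andP; split; lra.
  have -> : pi / 2 - pi / 4 = pi / 4 :> R by field.
  have -> : pi / 4 *+ 2 = pi / 2 :> R by rewrite mulr2n; field.
  rewrite sin_pihalf expr1n invr1 (_ : 2 ^+ 2 = 4 :> R); last by ring.
  lra.
(* Reversing the second half of the indices puts pi/2 - y opposite y. *)
rewrite expnS mul2n -addnn big_split_ord/= [X in _ + X](reindex_inj rev_ord_inj)/=.
rewrite -big_split/= [in RHS]exprS [RHS]mulrCA -IH mulr_sumr; apply: eq_bigr => k _.
have k2 := ltn_ord k.
have h2 : (0 < 2 ^+ n :> R) by rewrite exprn_gt0.
have hk : ((2 * k).+1%:R < 2 * 2 ^+ n :> R).
  rewrite -natrX -natrM ltr_nat; lia.
have -> : (2 * (2 ^ n + (2 ^ n - k.+1))).+1%:R * (pi / 2 ^+ n.+3) =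
    pi / 2 - (2 * k).+1%:R * (pi / 2 ^+ n.+3) :> R.
  have -> : ((2 * (2 ^ n + (2 ^ n - k.+1))).+1 = 4 * 2 ^ n - (2 * k).+1)%N by lia.
  rewrite natrB; last by lia.
  by rewrite natrM natrX !exprS; field; rewrite gt_eqF.
rewrite sin_half.
  congr (_ * sin _ ^- 2); rewrite -mulrnAr !exprS; field; rewrite gt_eqF//.
have k0 : (0 < (2 * k).+1%:R :> R) by rewrite ltr0n.
apply/andP; split; first by rewrite mulr_gt0// divr_gt0// exprn_gt0.
rewrite mulrA ltr_pdivrMr ?exprn_gt0// !exprS.
nra.
Qed.

Lemma basel_bounds_rescale (R : realFieldType) (P x s : R) : 0 < P -> 0 < x ->
  (P / (4 * x)) ^- 2 * s <= 2 * x ^+ 2 <= x + (P / (4 * x)) ^- 2 * s ->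
  P ^+ 2 / 8 * (1 - x^-1) <= s <= P ^+ 2 / 8.
Proof.
move=> P0 x0; have -> : (P / (4 * x)) ^- 2 = 16 * x ^+ 2 / P ^+ 2.
  by field; rewrite !gt_eqF.
have sE : s = P ^+ 2 / (16 * x ^+ 2) * (16 * x ^+ 2 / P ^+ 2 * s).
  by field; rewrite !gt_eqF.
have c0 : 0 <= P ^+ 2 / (16 * x ^+ 2).
  by apply: divr_ge0; [|apply: mulr_ge0 => //]; apply: sqr_ge0.
move=> /andP[lo hi]; rewrite sE; apply/andP; split.
  apply: (@le_trans _ _ (P ^+ 2 / (16 * x ^+ 2) * (2 * x ^+ 2 - x))); last first.
    by apply: ler_wpM2l => //; lra.
  rewrite -subr_ge0 (_ : _ - _ = P ^+ 2 / (16 * x)); last by field; rewrite gt_eqF.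
  by rewrite divr_ge0 ?sqr_ge0//; lra.
apply: le_trans (ler_wpM2l c0 lo) _.
by rewrite le_eqVlt; apply/orP; left; apply/eqP; field; rewrite gt_eqF.
Qed.

(** Sum the bounds on 1 / sin^2 over the 2^n angles (2k + 1) t. The explicit rate 2^-n is essential:
    the deficit is later multiplied by a quantity of order sqrt q, with n = q. *)
Lemma odd_basel_bounds (R : realType) (n : nat) :
  pi ^+ 2 / 8 * (1 - 2 ^- n) <= odd_series 2 (2 ^ n) (1 : R) <= pi ^+ 2 / 8.
Proof.
have pi0 := @pi_gt0 R.
set t : R := pi / 2 ^+ n.+2.
have h2 : (0 < 2 ^+ n :> R) by rewrite exprn_gt0.
have t0 : 0 < t by rewrite divr_gt0// exprn_gt0.
have bnd (k : 'I_(2 ^ n)) : 0 < (2 * k).+1%:R * t < pi / 2.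
  have k2 := ltn_ord k.
  rewrite mulr_gt0//= /t mulrA ltr_pdivrMr ?exprn_gt0// !exprS.
  have hk : ((2 * k).+1%:R < 2 * 2 ^+ n :> R) by rewrite -natrX -natrM ltr_nat; lia.
  nra.
have E : \sum_(k < 2 ^ n) ((2 * k).+1%:R * t) ^- 2 = t ^- 2 * odd_series 2 (2 ^ n) 1.
  rewrite /odd_series mulr_sumr; apply: eq_bigr => k _.
  by rewrite expr1n mul1r exprMn invfM mulrC.
have lo : t ^- 2 * odd_series 2 (2 ^ n) 1 <= 2 * 4 ^+ n.
  rewrite -E -sum_inv_sin2; apply: ler_sum => k _.
  by have /andP[] := inv_sin2_bounds (bnd k).
have hi : 2 * 4 ^+ n <= 2 ^+ n + t ^- 2 * odd_series 2 (2 ^ n) 1.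
  have -> : 2 ^+ n = \sum_(k < 2 ^ n) 1 :> R.
    by rewrite sumr_const card_ord natrX.
  rewrite -E -sum_inv_sin2 -big_split/=; apply: ler_sum => k _.
  by have /andP[] := inv_sin2_bounds (bnd k).
rewrite -natrX; apply: basel_bounds_rescale => //; rewrite natrX//.
have -> : pi / (4 * 2 ^+ n) = t by rewrite /t !exprS; congr (_ / _); ring.
have -> : (2 ^+ n) ^+ 2 = 4 ^+ n :> R by rewrite exprAC; congr (_ ^+ _); ring.
exact/andP.
Qed.

(** * Comparison of exponential sums with integrals *)

Definition node (R : realType) (c x : R) : R := c * Num.sqrt x.

(* Antiderivatives of [x |-> exp(w (c sqrt x - t))] and, up to sign, of
   [x |-> exp(- w (c sqrt x - t))], in the variable [p = c sqrt x]. *)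
Definition rising_primitive (R : realType) (c w t p : R) : R :=
  2 / c ^+ 2 * (expR (w * (p - t)) * (p / w - w ^- 2)).

Definition falling_primitive (R : realType) (c w t p : R) : R :=
  2 / c ^+ 2 * (expR (- (w * (p - t))) * (p / w + w ^- 2)).

Lemma expR_mulB (R : realType) (w p t : R) :
  expR (w * (p - t)) = expR (w * p) * expR (- (w * t)).
Proof. by rewrite -expRD; congr expR; ring. Qed.

Lemma expRN_mulB (R : realType) (w p t : R) :
  expR (- (w * (p - t))) = expR (- (w * p)) * expR (w * t).
Proof. by rewrite -expRD; congr expR; ring. Qed.

(** The variable w p reduces the primitive to that of [exp(sqrt u)], for which the trapezoidal
    inequality is available. *)
Lemma rising_primitiveE (R : realType) (c w t p : R) : 0 < c -> 0 < w ->
  rising_primitive c w t p =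
  expR (- (w * t)) / (c * w) ^+ 2 * (2 * (expR (w * p) * (w * p - 1))).
Proof.
move=> c0 w0; rewrite /rising_primitive expR_mulB.
by field; rewrite !gt_eqF.
Qed.

Lemma falling_primitiveE (R : realType) (c w t p : R) : 0 < c -> 0 < w ->
  falling_primitive c w t p =
  expR (w * t) / (c * w) ^+ 2 * (2 * (expR (- (w * p)) * (w * p + 1))).
Proof.
move=> c0 w0; rewrite /falling_primitive expRN_mulB.
by field; rewrite !gt_eqF.
Qed.

Lemma rising_primitive_le (R : realType) (c w t p p' : R) :
  0 < c -> 0 < w -> 0 <= p -> p <= p' ->
  rising_primitive c w t p' - rising_primitive c w t p <=
  (p' ^+ 2 - p ^+ 2) / c ^+ 2 * expR (w * (p' - t)).
Proof.
move=> c0 w0 p0 pp'.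
rewrite !rising_primitiveE// -mulrBr -mulrBr.
have -> : (p' ^+ 2 - p ^+ 2) / c ^+ 2 * expR (w * (p' - t)) =
    expR (- (w * t)) / (c * w) ^+ 2 * (((w * p') ^+ 2 - (w * p) ^+ 2) * expR (w * p')).
  by rewrite expR_mulB; field; rewrite !gt_eqF.
apply: ler_wpM2l; first by rewrite divr_ge0 ?expR_ge0 ?sqr_ge0.
by apply: rising_antiderivative_le; nra.
Qed.

Lemma rising_primitive_trapezoid (R : realType) (c w t p p' : R) :
  0 < c -> 0 < w -> 1 <= w * p -> p <= p' ->
  rising_primitive c w t p' - rising_primitive c w t p <=
  2^-1 * ((p' ^+ 2 - p ^+ 2) / c ^+ 2) * (expR (w * (p - t)) + expR (w * (p' - t))).
Proof.
move=> c0 w0 p1 pp'.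
rewrite !rising_primitiveE// -mulrBr -mulrBr.
set rhs := (X in _ <= X).
have -> : rhs = expR (- (w * t)) / (c * w) ^+ 2 *
    (2^-1 * ((w * p') ^+ 2 - (w * p) ^+ 2) * (expR (w * p) + expR (w * p'))).
  by rewrite /rhs !expR_mulB; field; rewrite !gt_eqF.
apply: ler_wpM2l; first by rewrite divr_ge0 ?expR_ge0 ?sqr_ge0.
by apply: rising_trapezoid_le; nra.
Qed.

Lemma falling_primitive_trapezoid (R : realType) (c w t p p' : R) :
  0 < c -> 0 < w -> 0 <= p -> p <= p' ->
  falling_primitive c w t p - falling_primitive c w t p' <=
  2^-1 * ((p' ^+ 2 - p ^+ 2) / c ^+ 2) *
    (expR (- (w * (p - t))) + expR (- (w * (p' - t)))).
Proof.
move=> c0 w0 p0 pp'.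
rewrite !falling_primitiveE// -mulrBr -mulrBr.
set rhs := (X in _ <= X).
have -> : rhs = expR (w * t) / (c * w) ^+ 2 *
    (2^-1 * ((w * p') ^+ 2 - (w * p) ^+ 2) * (expR (- (w * p)) + expR (- (w * p')))).
  by rewrite /rhs !expRN_mulB; field; rewrite !gt_eqF.
apply: ler_wpM2l; first by rewrite divr_ge0 ?expR_ge0 ?sqr_ge0.
by apply: falling_trapezoid_le; nra.
Qed.

Lemma falling_primitive_le (R : realType) (c w t p p' : R) :
  0 < c -> 0 < w -> 0 <= p -> p <= p' ->
  falling_primitive c w t p - falling_primitive c w t p' <=
  (p' ^+ 2 - p ^+ 2) / c ^+ 2 * expR (- (w * (p - t))).
Proof.
move=> c0 w0 p0 pp'; have := falling_primitive_trapezoid t c0 w0 p0 pp'.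
have : expR (- (w * (p' - t))) <= expR (- (w * (p - t))) by rewrite ler_expR; nra.
have : 0 <= (p' ^+ 2 - p ^+ 2) / c ^+ 2.
  by rewrite divr_ge0 ?sqr_ge0// subr_ge0 ler_sqr ?nnegrE //; lra.
nra.
Qed.

(** The main term of the integral of exp(- w |c sqrt x - t|): at the peak the two w^-2 contributions
    cancel. *)
Lemma primitives_at_peak (R : realType) (c w t : R) : 0 < c -> 0 < w ->
  rising_primitive c w t t + falling_primitive c w t t = 4 * t / (c ^+ 2 * w).
Proof.
move=> c0 w0; rewrite /rising_primitive /falling_primitive subrr mulr0 oppr0 expR0.
by field; rewrite !gt_eqF.
Qed.

(** By [primitives_at_peak], the left side is the integral over the cell containing the peak; the
    integrand is at most 1 and the cell has length 1 in x. *)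
Lemma peak_increment_le1 (R : realType) (c w t p p' : R) :
  0 < c -> 0 < w -> 0 <= p -> p <= t -> t <= p' -> p' ^+ 2 - p ^+ 2 = c ^+ 2 ->
  4 * t / (c ^+ 2 * w) - rising_primitive c w t p - falling_primitive c w t p' <= 1.
Proof.
move=> c0 w0 p0 pt tp' pp'; rewrite -primitives_at_peak//.
have := rising_primitive_le t c0 w0 p0 pt.
have := falling_primitive_le t c0 w0 (le_trans p0 pt) tp'.
rewrite subrr mulr0 oppr0 expR0 !mulr1.
have : (p' ^+ 2 - t ^+ 2) / c ^+ 2 + (t ^+ 2 - p ^+ 2) / c ^+ 2 = 1.
  by rewrite -mulrDl addrA subrK pp' divff// sqrf_eq0 gt_eqF.
lra.
Qed.

(** A second bound on the same integral, decaying in w, for cells that are wide compared with 1 / w.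
    It rests on c^2 = (p' - p)(p' + p). *)
Lemma peak_increment_le (R : realType) (c w t p p' : R) :
  0 < c -> 0 < w -> 0 <= p -> p <= t -> t <= p' -> p' ^+ 2 - p ^+ 2 = c ^+ 2 ->
  4 * t / (c ^+ 2 * w) - rising_primitive c w t p - falling_primitive c w t p' <=
  4 / (w * (p' - p)).
Proof.
move=> c0 w0 p0 pt tp' pp'.
have pltp' : p < p'.
  rewrite lt_neqAle (le_trans pt tp') andbT; apply/eqP => E.
  by move: pp'; rewrite E subrr => /esym/eqP; rewrite sqrf_eq0 gt_eqF.
have dE : 4 / (w * (p' - p)) = 2 / (c ^+ 2 * w ^+ 2) * (2 * (w * (p + p'))).
  by rewrite -pp'; field; apply/and3P; split; apply/eqP; nra.
have k0 : 0 <= 2 / (c ^+ 2 * w ^+ 2).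
  by apply: divr_ge0 => //; apply: mulr_ge0; apply: sqr_ge0.
rewrite dE [leLHS](_ : _ = 2 / (c ^+ 2 * w ^+ 2) *
   ((2 * (w * t) - expR (w * (p - t)) * (w * p - 1)) -
    expR (- (w * (p' - t))) * (w * p' + 1))); last first.
  rewrite /rising_primitive /falling_primitive; field.
  by rewrite !gt_eqF.
apply: ler_wpM2l => //.
have e1 : expR (w * (p - t)) <= 1 by rewrite expR_le1; nra.
have e2 : 0 <= expR (w * (p - t)) by exact: expR_ge0.
have e3 := expR_ge1Dx (- (w * (p' - t))).
have e4 : 0 <= expR (- (w * (p' - t))) by exact: expR_ge0.
have wp : 0 <= w * p by nra.
have h1 : - (expR (w * (p - t)) * (w * p - 1)) <= 1 by nra.
have h2 : w * t + 1 - expR (- (w * (p' - t))) * (w * p' + 1) <= w * p'.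
  have wp' : 0 <= w * p' by nra.
  (* If w (p' - t) >= 1, the added 1 is absorbed by w p' - w t; otherwise the tangent bound [e3] on
     the exponential suffices. *)
  have [h|h] := leP 1 (w * (p' - t)).
    have : 0 <= expR (- (w * (p' - t))) * (w * p' + 1) by apply: mulr_ge0 => //; lra.
    lra.
  have : 0 <= (expR (- (w * (p' - t))) - (1 - w * (p' - t))) * (w * p' + 1).
    by apply: mulr_ge0; lra.
  have : 0 <= (1 - w * (p' - t)) * (w * p') by apply: mulr_ge0; lra.
  lra.
have : w * t <= w * p' by rewrite ler_wpM2l// ltW.
lra.
Qed.

Lemma node_ge0 (R : realType) (c x : R) : 0 <= c -> 0 <= node c x.
Proof. by move=> c0; rewrite mulr_ge0 ?sqrtr_ge0. Qed.

Lemma le_node (R : realType) (c x y : R) : 0 <= c -> x <= y -> node c x <= node c y.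
Proof. by move=> c0 xy; rewrite ler_wpM2l// ler_wsqrtr. Qed.

Lemma node_sqrB (R : realType) (c : R) (k : nat) :
  node c k.+1%:R ^+ 2 - node c k%:R ^+ 2 = c ^+ 2.
Proof. by rewrite /node !exprMn !sqr_sqrtr ?ler0n// -natr1; ring. Qed.

Definition exp_dist (R : realType) (c w t x : R) : R :=
  expR (- (w * `|node c x - t|)).

Lemma exp_dist_ge0 (R : realType) (c w t x : R) : 0 <= exp_dist c w t x.
Proof. exact: expR_ge0. Qed.

Lemma exp_dist_left (R : realType) (c w t x : R) : node c x <= t ->
  exp_dist c w t x = expR (w * (node c x - t)).
Proof.
by move=> xt; rewrite /exp_dist ler0_norm ?subr_le0//; congr expR; ring.
Qed.

Lemma exp_dist_right (R : realType) (c w t x : R) : t <= node c x ->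
  exp_dist c w t x = expR (- (w * (node c x - t))).
Proof. by move=> xt; rewrite /exp_dist ger0_norm ?subr_ge0. Qed.

(** Adding the trapezoidal rules cell by cell leaves half of the weight at [m] unspent, to be used
    for the peak cell. Starting at [K] ensures convexity on every cell, for all w >= 1 at once. *)
Lemma left_trapezoid_sum (R : realType) (c w t : R) (K m : nat) :
  0 < c -> 1 <= w -> 1 <= node c K%:R -> (K <= m)%N -> node c m%:R <= t ->
  rising_primitive c w t (node c m%:R) - rising_primitive c w t (node c K%:R)
    + 2^-1 * exp_dist c w t m%:R
  <= \sum_(K <= k < m.+1) exp_dist c w t k%:R.
Proof.
move=> c0 w1 K1 Km; have w0 : 0 < w by lra.
rewrite -(subnKC Km); elim: (m - K)%N => [|d IH] mt.
  rewrite addn0 big_nat1 subrr add0r; have := exp_dist_ge0 c w t K%:R; lra.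
rewrite addnS in mt *.
have le1 : node c (K + d)%:R <= node c (K + d).+1%:R.
  by apply: le_node; [exact: ltW|rewrite ler_nat].
have mt' := le_trans le1 mt.
have {}IH := IH mt'.
have K2 : node c K%:R <= node c (K + d)%:R.
  by apply: le_node; [exact: ltW|rewrite ler_nat leq_addr].
rewrite big_nat_recr/=; last by lia.
have wp : 1 <= w * node c (K + d)%:R by nra.
have := rising_primitive_trapezoid t c0 w0 wp le1.
rewrite node_sqrB divff ?sqrf_eq0 ?gt_eqF// mulr1 -!exp_dist_left//.
lra.
Qed.

(** Here half of the weight at [a] is left for the peak cell, while half of the weight at [q], which
    is not a node of the sum, is borrowed. *)
Lemma right_trapezoid_sum (R : realType) (c w t : R) (a q : nat) :
  0 < c -> 0 < w -> (a <= q)%N -> t <= node c a%:R ->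
  falling_primitive c w t (node c a%:R) - falling_primitive c w t (node c q%:R)
    + 2^-1 * exp_dist c w t a%:R
  <= \sum_(a <= k < q) exp_dist c w t k%:R + 2^-1 * exp_dist c w t q%:R.
Proof.
move=> c0 w0 aq ta; rewrite -(subnKC aq); elim: (q - a)%N => [|d IH].
  by rewrite addn0 big_geq// subrr add0r.
rewrite addnS.
have le1 : node c (a + d)%:R <= node c (a + d).+1%:R.
  by apply: le_node; [exact: ltW|rewrite ler_nat].
have a2 : node c a%:R <= node c (a + d)%:R.
  by apply: le_node; [exact: ltW|rewrite ler_nat leq_addr].
rewrite big_nat_recr/=; last by lia.
have p0 : 0 <= node c (a + d)%:R by apply: node_ge0; exact: ltW.
have := falling_primitive_trapezoid t c0 w0 p0 le1.
rewrite node_sqrB divff ?sqrf_eq0 ?gt_eqF// mulr1 -!exp_dist_right; [|lra|lra].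
lra.
Qed.

Lemma exp_dist_ge (R : realType) (c w t x D : R) : 0 <= w ->
  `|node c x - t| <= D -> expR (- (w * D)) <= exp_dist c w t x.
Proof. by move=> w0 xD; rewrite ler_expR lerN2 ler_wpM2l. Qed.

(** The nodes before [K] are discarded; this costs at most the rising primitive at [K], bounded by 2
    c sqrt K / (c^2 w). If m < K, the same quantity dominates the primitive at [m], and the single
    term at [m] is enough. *)
Lemma left_sum_ge (R : realType) (c w t D : R) (K m : nat) :
  0 < c -> 1 <= w -> 1 <= node c K%:R -> node c m%:R <= t -> t - node c m%:R <= D ->
  rising_primitive c w t (node c m%:R) - 2 * node c K%:R / (c ^+ 2 * w)
    + 2^-1 * expR (- (w * D))
  <= \sum_(0 <= k < m.+1) exp_dist c w t k%:R.
Proof.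
move=> c0 w1 K1 mt tD; have w0 : 0 < w by lra.
have fm : expR (- (w * D)) <= exp_dist c w t m%:R.
  by apply: exp_dist_ge; [lra|rewrite ler0_norm; lra].
have prim_le (p : R) : 0 <= p -> p <= t -> rising_primitive c w t p <= 2 * p / (c ^+ 2 * w).
  move=> p0 pt.
  rewrite [leRHS](_ : _ = 2 / c ^+ 2 * (p / w)); last by field; rewrite !gt_eqF.
  apply: ler_wpM2l; first by rewrite divr_ge0 ?sqr_ge0.
  have e1 : expR (w * (p - t)) <= 1 by rewrite expR_le1; nra.
  have e0 := expR_ge0 (w * (p - t)).
  have : 0 <= p / w by rewrite divr_ge0// ltW.
  have : 0 <= w ^- 2 by rewrite invr_ge0 sqr_ge0.
  nra.
have n0 k : 0 <= node c k%:R by apply: node_ge0; exact: ltW.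
have [Km|mK] := leqP K m.
  have Kt : node c K%:R <= t.
    by apply: le_trans mt; apply: le_node; [exact: ltW|rewrite ler_nat].
  rewrite (@big_cat_nat _ _ _ K 0 m.+1)//=; last by lia.
  have := left_trapezoid_sum c0 w1 K1 Km mt.
  have := prim_le _ (n0 K) Kt.
  have : 0 <= \sum_(0 <= k < K) exp_dist c w t k%:R.
    by apply: sumr_ge0 => k _; exact: exp_dist_ge0.
  lra.
rewrite big_nat_recr//=.
have : 0 <= \sum_(0 <= k < m) exp_dist c w t k%:R.
  by apply: sumr_ge0 => k _; exact: exp_dist_ge0.
have := prim_le _ (n0 m) mt.
have : 2 * node c m%:R / (c ^+ 2 * w) <= 2 * node c K%:R / (c ^+ 2 * w).
  apply: ler_wpM2r.
    by rewrite invr_ge0; apply: mulr_ge0; [exact: sqr_ge0|exact: ltW].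
  by apply: ler_wpM2l => //; apply: le_node; [exact: ltW|rewrite ler_nat ltnW].
have := expR_ge0 (- (w * D)).
lra.
Qed.

(** The point at q - 1/2 repays the half weight borrowed at [q], being nearer to the peak. *)
Lemma right_sum_ge (R : realType) (c w t : R) (m q : nat) :
  0 < c -> 0 < w -> (m < q)%N -> node c m%:R <= t <= node c m.+1%:R ->
  falling_primitive c w t (node c m.+1%:R) - falling_primitive c w t (node c q%:R)
    + 2^-1 * expR (- (w * (node c m.+1%:R - node c m%:R)))
  <= \sum_(m.+1 <= k < q) exp_dist c w t k%:R + exp_dist c w t (q%:R - 1 / 2).
Proof.
move=> c0 w0 mq /andP[mt tm].
have le_n x y : x <= y -> node c x <= node c y by apply: le_node; exact: ltW.
have := right_trapezoid_sum c0 w0 mq tm.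
have qhalf : node c (q%:R - 1 / 2) <= node c q%:R by apply: le_n; lra.
(* When the peak lies in the last cell the sum is empty, and the point at q - 1/2, which lies in
   that cell, supplies the half weight by itself. *)
have [qm|qm] := leqP q m.+1.
  have -> : q = m.+1 by apply/eqP; rewrite eqn_leq qm.
  rewrite big_geq// subrr !add0r.
  have half1 : node c m%:R <= node c (m.+1%:R - 1 / 2).
    by apply: le_n; rewrite -natr1; lra.
  have half2 : node c (m.+1%:R - 1 / 2) <= node c m.+1%:R by apply: le_n; lra.
  have := @exp_dist_ge _ c w t (m.+1%:R - 1 / 2) (node c m.+1%:R - node c m%:R) (ltW w0).
  rewrite ler_norml => /(_ ltac:(apply/andP; split; lra)).
  have := expR_ge0 (- (w * (node c m.+1%:R - node c m%:R))); lra.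
have th : t <= node c (q%:R - 1 / 2).
  apply: le_trans tm _; apply: le_n.
  have : m.+1%:R + 1 <= q%:R :> R by rewrite natr1 ler_nat.
  lra.
have h1 : exp_dist c w t q%:R <= exp_dist c w t (q%:R - 1 / 2).
  rewrite !exp_dist_right//; last by lra.
  by rewrite ler_expR lerN2; apply: ler_wpM2l; [exact: ltW|lra].
have h2 : expR (- (w * (node c m.+1%:R - node c m%:R))) <= exp_dist c w t m.+1%:R.
  by apply: exp_dist_ge; [lra|rewrite ger0_norm; lra].
have := exp_dist_ge0 c w t q%:R; lra.
Qed.

(** The subtracted terms are, in order: the two parts of the falling primitive at [q] (truncation of
    the integral), the discarded nodes before [K], and the error of the peak cell. *)
Lemma exp_dist_sum_ge (R : realType) (c w t : R) (K m q : nat) :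
  0 < c -> 1 <= w -> 1 <= node c K%:R -> (m < q)%N ->
  node c m%:R <= t <= node c m.+1%:R ->
  let D := node c m.+1%:R - node c m%:R in
  4 * t / (c ^+ 2 * w)
  - 2 * node c q%:R / (c ^+ 2 * w) * expR (- (w * (node c q%:R - t)))
  - 2 / (c * w) ^+ 2 - 2 * node c K%:R / (c ^+ 2 * w)
  - 16 * (w * D) / (1 + w * D) ^+ 2
  <= \sum_(0 <= k < q) exp_dist c w t k%:R + exp_dist c w t (q%:R - 1 / 2).
Proof.
move=> c0 w1 K1 mq mtm; set D := _ - node c m%:R; have w0 : 0 < w by lra.
have /andP[mt tm] := mtm.
have n0 x : 0 <= node c x by apply: node_ge0; exact: ltW.
have qt : t <= node c q%:R.
  by apply: le_trans tm _; apply: le_node; [exact: ltW|rewrite ler_nat].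
have LD : t - node c m%:R <= D by rewrite /D; lra.
have := left_sum_ge c0 w1 K1 mt LD.
have := right_sum_ge c0 w0 mq mtm; rewrite -/D.
have := peak_increment_le1 c0 w0 (n0 m%:R) mt tm (node_sqrB c m).
have := peak_increment_le c0 w0 (n0 m%:R) mt tm (node_sqrB c m); rewrite -/D.
set X := 4 * t / (c ^+ 2 * w) - _ - _ => X1 X2.
rewrite (@big_cat_nat _ _ _ m.+1 0 q)//=.
have D0 : 0 <= D by rewrite /D; lra.
set Y := w * D in X1 *; have Y0 : 0 <= Y by rewrite mulr_ge0// ltW.
have e1 := expR_ge1Dx (- Y); have e0 := expR_ge0 (- Y).
(* The two half weights add up to exp(- Y), so the error is at most min(Y, 4 / Y); the rational
   majorant has the advantage of telescoping when summed over w. *)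
have err : X - expR (- Y) <= 16 * Y / (1 + Y) ^+ 2.
  rewrite ler_pdivlMr; last by rewrite exprn_gt0//; lra.
  have [Y1|Y1] := leP Y 1.
    have : (X - expR (- Y)) * (1 + Y) ^+ 2 <= Y * (1 + Y) ^+ 2.
      by apply: ler_wpM2r; [exact: sqr_ge0|lra].
    nra.
  have : (X - expR (- Y)) * (1 + Y) ^+ 2 <= 4 / Y * (1 + Y) ^+ 2.
    by apply: ler_wpM2r; [exact: sqr_ge0|lra].
  have : 4 / Y * (1 + Y) ^+ 2 <= 16 * Y.
    rewrite mulrAC ler_pdivrMr; last by lra.
    nra.
  lra.
have fq : falling_primitive c w t (node c q%:R) <=
    2 * node c q%:R / (c ^+ 2 * w) * expR (- (w * (node c q%:R - t))) + 2 / (c * w) ^+ 2.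
  rewrite -subr_ge0 (_ : _ - _ = 2 / (c * w) ^+ 2 * (1 - expR (- (w * (node c q%:R - t))))).
    apply: mulr_ge0; first by rewrite divr_ge0 ?sqr_ge0.
    by rewrite subr_ge0 expR_le1 oppr_le0; apply: mulr_ge0; [exact: ltW|lra].
  by rewrite /falling_primitive; field; rewrite !gt_eqF.
rewrite /X in err; lra.
Qed.

(** * Products over the sampling points *)

Lemma odd_series_ge0 (R : realType) (p J : nat) (z : R) : 0 <= z -> 0 <= odd_series p J z.
Proof.
by move=> z0; apply: sumr_ge0 => j _; rewrite divr_ge0// exprn_ge0// ler0n.
Qed.

Lemma le_odd_series (R : realType) (p J : nat) (y z : R) :
  0 <= y -> y <= z -> odd_series p J y <= odd_series p J z.
Proof.
move=> y0 yz; apply: ler_sum => j _.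
apply: ler_wpM2r; first by rewrite invr_ge0 exprn_ge0// ler0n.
by apply: lerXn2r; rewrite ?nnegrE// (le_trans y0).
Qed.

Lemma odd_series2_le1 (R : realType) (J : nat) (z : R) :
  0 <= z -> odd_series 2 J z <= odd_series 1 J z.
Proof.
move=> z0; apply: ler_sum => j _; apply: ler_wpM2l; first exact: exprn_ge0.
have w1 : 1 <= (2 * j).+1%:R :> R by rewrite ler1n.
have w0 : 0 < (2 * j).+1%:R :> R by rewrite ltr0n.
rewrite lef_pV2 ?posrE ?exprn_gt0// expr1 expr2; nra.
Qed.

(** With z = exp(- |v - u|) the ratio equals (1 - z) / (1 + z) = exp(- 2 artanh z). *)
Lemma distance_ratio_le (R : realType) (J : nat) (u v : R) :
  `|(expR u - expR v) / (expR u + expR v)| <=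
  expR (- (2 * odd_series 1 J (expR (- `|v - u|)))).
Proof.
wlog vu : u v / v <= u.
  move=> H; have [/H//|/ltW/H] := leP v u.
  rewrite (distrC u v) [X in _ -> `|X| <= _](_ : _ =
    - ((expR v - expR u) / (expR v + expR u))) ?normrN//.
  by rewrite -mulNr opprB (addrC (expR v)).
rewrite [`|v - u|]ler0_norm ?subr_le0// opprK.
set z := expR (v - u).
have vE : expR v = expR u * z by rewrite /z -expRD; congr expR; ring.
have u0 := expR_gt0 u; have z0 : 0 < z := expR_gt0 _.
have z1 : z <= 1 by rewrite expR_le1 subr_le0.
rewrite vE (_ : _ / _ = (1 - z) / (1 + z)); last first.
  by field; apply/andP; split; apply/eqP; nra.
rewrite ger0_norm; last by rewrite divr_ge0; lra.
rewrite ler_pdivrMr; last by lra.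
by rewrite mulrC; apply: one_sub_le_odd_series; rewrite ltW.
Qed.

(** The term of index j is at most 1 / (1 + 2jD) - 1 / (1 + (2j + 2)D), so the sum telescopes,
    uniformly in [J] and [D]. *)
Lemma sum_peak_error_le1 (R : realType) (J : nat) (D : R) : 0 <= D ->
  \sum_(j < J) D / (1 + (2 * j).+1%:R * D) ^+ 2 <= 1.
Proof.
move=> D0; suff : \sum_(j < J) D / (1 + (2 * j).+1%:R * D) ^+ 2
    <= 1 - (1 + (2 * J)%:R * D)^-1.
  have : 0 <= (1 + (2 * J)%:R * D)^-1.
    by rewrite invr_ge0 addr_ge0// mulr_ge0// ler0n.
  lra.
elim: J => [|J IH]; first by rewrite big_ord0 muln0 mul0r addr0 invr1 subrr.
rewrite big_ord_recr/=; apply: (le_trans (lerD IH (lexx _))).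
have e1 : (2 * J).+1%:R = (2 * J)%:R + 1 :> R by rewrite natr1.
have e2 : (2 * J.+1)%:R = (2 * J)%:R + 2 :> R by rewrite mulnS addnC natrD.
rewrite e1 e2; set x : R := (2 * J)%:R.
have x0 : 0 <= x by exact: ler0n.
have xD : 0 <= x * D by exact: mulr_ge0.
rewrite -subr_ge0 (_ : _ - _ = D * ((1 + (x + 1) * D) ^+ 2 + D ^+ 2) /
    ((1 + x * D) * (1 + (x + 2) * D) * (1 + (x + 1) * D) ^+ 2)); last first.
  by field; apply/and3P; split; apply/eqP; nra.
apply: divr_ge0; first by rewrite mulr_ge0// addr_ge0// sqr_ge0.
by rewrite !mulr_ge0 ?sqr_ge0//; nra.
Qed.

Lemma weighted_exp_dist_sum_ge (R : realType) (c t : R) (K m q J : nat) :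
  0 < c -> 1 <= node c K%:R -> (m < q)%N ->
  node c m%:R <= t <= node c m.+1%:R ->
  (8 * t - 4 * node c K%:R - 4) / c ^+ 2 * odd_series 2 J 1
  - 4 * node c q%:R / c ^+ 2 * odd_series 2 J (expR (t - node c q%:R)) - 32
  <= \sum_(j < J) 2 / (2 * j).+1%:R *
       (\sum_(0 <= k < q) exp_dist c (2 * j).+1%:R t k%:R
        + exp_dist c (2 * j).+1%:R t (q%:R - 1 / 2)).
Proof.
move=> c0 K1 mq mtm.
set D := node c m.+1%:R - node c m%:R.
have D0 : 0 <= D by rewrite /D; lra.
have := sum_peak_error_le1 J D0; set err := \sum_(j < J) _ => err1.
apply: (@le_trans _ _ ((8 * t - 4 * node c K%:R - 4) / c ^+ 2 * odd_series 2 J 1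
  - 4 * node c q%:R / c ^+ 2 * odd_series 2 J (expR (t - node c q%:R)) - 32 * err)).
  lra.
rewrite /odd_series /err !mulr_sumr -!sumrB; apply: ler_sum => j _.
have w1 : 1 <= (2 * j).+1%:R :> R by rewrite ler1n.
have := exp_dist_sum_ge c0 w1 K1 mq mtm; rewrite -/D.
rewrite -expRM_natl; set w : R := (2 * j).+1%:R in w1 *.
have w0 : 0 < w by lra.
have -> : - (w * (node c q%:R - t)) = w * (t - node c q%:R) by ring.
set e := expR _; set S := _ + exp_dist _ _ _ _ => lo.
have k0 : 0 <= 2 / w by rewrite divr_ge0// ltW.
apply: le_trans (ler_wpM2l k0 lo).
have wD0 : 0 <= w * D by rewrite mulr_ge0// ltW.
(* The only loss is the replacement of 4 / (c^2 w^3) by 4 / (c^2 w^2), so that a single odd series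
   appears. *)
rewrite expr1n -subr_ge0 (_ : _ - _ = 4 / (c ^+ 2 * w ^+ 3) * (w - 1)).
  rewrite mulr_ge0 ?subr_ge0// divr_ge0// mulr_ge0 ?sqr_ge0// exprn_ge0// ltW.
by field; rewrite !gt_eqF//; lra.
Qed.

Definition node_factor (R : realType) (c T t x : R) : R :=
  `|(expR (t - T) - expR (node c x - T)) / (expR (t - T) + expR (node c x - T))|.

Lemma node_product_le (R : realType) (c t : R) (K m q J : nat) :
  0 < c -> 1 <= node c K%:R -> (m < q)%N ->
  node c m%:R <= t <= node c m.+1%:R ->
  (\prod_(0 <= k < q) node_factor c (node c q%:R) t k%:R) *
    node_factor c (node c q%:R) t (q%:R - 1 / 2) <=
  expR (- ((8 * t - 4 * node c K%:R - 4) / c ^+ 2 * odd_series 2 J 1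
    - 4 * node c q%:R / c ^+ 2 * odd_series 2 J (expR (t - node c q%:R)) - 32)).
Proof.
move=> c0 K1 mq mtm; set T := node c q%:R; set factor := node_factor c T t.
have factor_ge0 x : 0 <= factor x by exact: normr_ge0.
have factor_le x : factor x <=
    expR (- (\sum_(j < J) 2 / (2 * j).+1%:R * exp_dist c (2 * j).+1%:R t x)).
  apply: (le_trans (distance_ratio_le J _ _)).
  rewrite ler_expR lerN2 /odd_series mulr_sumr; apply: ler_sum => j _.
  rewrite -expRM_natl expr1 /exp_dist mulrN.
  have -> : node c x - T - (t - T) = node c x - t by ring.
  by rewrite mulrA mulrAC.
apply: (@le_trans _ _ ((\prod_(0 <= k < q) expR (- (\sum_(j < J) 2 / (2 * j).+1%:R
     * exp_dist c (2 * j).+1%:R t k%:R)))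
   * expR (- (\sum_(j < J) 2 / (2 * j).+1%:R
     * exp_dist c (2 * j).+1%:R t (q%:R - 1 / 2))))).
  apply: ler_pM => //; first exact: prodr_ge0.
  by apply: ler_prod => k _; rewrite factor_ge0 factor_le.
rewrite -expR_sum -expRD ler_expR sumrN -opprD lerN2.
apply: le_trans (weighted_exp_dist_sum_ge J c0 K1 mq mtm) _.
rewrite exchange_big/= -big_split/=; apply: ler_sum => j _.
by rewrite -mulr_sumr -mulrDr.
Qed.

(** For z = 7/9 one has (1 - z) / (1 + z) = 1/8, and four terms of the series of artanh z already
    exceed 1. *)
Lemma expRN2_ge (R : realType) : 8^-1 <= expR (- 2) :> R.
Proof.
have /(one_sub_le_odd_series 4) : 0 <= (7 / 9 : R) <= 1 by apply/andP; split; lra.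
have : 1 <= odd_series 1 4 (7 / 9 : R).
  rewrite /odd_series !big_ord_recr big_ord0/= muln0 -[(2 * 1)%N]/2%N -[(2 * 2)%N]/4%N.
  rewrite -[(2 * 3)%N]/6%N !expr1; lra.
set P := odd_series _ _ _ => P1 H.
have : expR (- (2 * P)) <= expR (- 2) by rewrite ler_expR; lra.
lra.
Qed.

(** For s <= 4/5 the factor is at most (1 - s) / (1 + s), hence at most exp(- 2 artanh s). For s >
    4/5 it is at most (1/5) / (8/5) = 1/8 <= exp(-2), and the exponent on the right is at least -2
    because the series at 1 is at most pi^2 / 8. *)
Lemma extra_factor_le (R : realType) (n : nat) (s a : R) :
  0 <= s <= 1 -> 4 / 5 <= a <= 1 ->
  `|(s - a) / (s + a)| <= expR (- (16 / pi ^+ 2 * odd_series 2 (2 ^ n) s)).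
Proof.
move=> /andP[s0 s1] /andP[a0 a1].
have pi2 : 0 < pi ^+ 2 :> R by rewrite exprn_gt0// pi_gt0.
have chi0 := odd_series_ge0 2 (2 ^ n) s0.
have k0 : 0 <= 16 / pi ^+ 2 :> R by rewrite divr_ge0// ltW.
(* That is, pi^2 >= 8: the first term of the odd Basel sum is 1. *)
have k2 : 16 / pi ^+ 2 <= 2 :> R.
  have /andP[_] := odd_basel_bounds R 0.
  rewrite /odd_series expn0 big_ord1 muln0 !expr1n divr1 ler_pdivlMr// => h.
  rewrite ler_pdivrMr//; lra.
have sa : 0 < s + a by lra.
have [s8|s8] := leP s (4 / 5).
  apply: (@le_trans _ _ ((1 - s) / (1 + s))).
    rewrite ler0_norm; last by rewrite pmulr_lle0 ?invr_gt0//; lra.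
    rewrite -mulNr ler_pdivrMr// mulrAC ler_pdivlMr; last by lra.
    nra.
  rewrite ler_pdivrMr; last by lra.
  rewrite mulrC; apply: (le_trans (one_sub_le_odd_series (2 ^ n) _)).
    by apply/andP.
  apply: ler_wpM2l; first by lra.
  rewrite ler_expR lerN2.
  by apply: ler_pM => //; exact: odd_series2_le1.
apply: (@le_trans _ _ 8^-1).
  rewrite normrM [`|(s + a)^-1|]gtr0_norm ?invr_gt0// ler_pdivrMr//.
  by rewrite ler_norml; apply/andP; split; lra.
apply: (le_trans (expRN2_ge R)); rewrite ler_expR lerN2.
have /andP[_ hb] := odd_basel_bounds R n.
have le1 := le_odd_series 2 (2 ^ n) s0 s1.
apply: (@le_trans _ _ (16 / pi ^+ 2 * (pi ^+ 2 / 8))).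
  by apply: ler_wpM2l => //; exact: le_trans hb.
have cancel (x : R) : x != 0 -> 16 / x * (x / 8) = 2 by move=> x0; field.
by rewrite cancel// gt_eqF.
Qed.

Lemma factor_le1 (R : realType) (s a : R) : 0 <= s -> 0 < a ->
  `|(s - a) / (s + a)| <= 1.
Proof.
move=> s0 a0; rewrite normrM [`|(s + a)^-1|]gtr0_norm ?invr_gt0; last by lra.
by rewrite ler_pdivrMr ?mul1r; [rewrite ler_norml; apply/andP; split|]; lra.
Qed.

(** * Location and number of the sampling points *)

Lemma phi_ratio (R : realType) (r x y : R) : 0 < r -> 0 <= x -> 0 <= y ->
  ganelius_phi r x / ganelius_phi r y =
  expR (node (pi / Num.sqrt r) x - node (pi / Num.sqrt r) y).
Proof.
move=> r0 x0 y0; rewrite /ganelius_phi -expRB /node !sqrtrM// sqrtrV ?ltW//.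
by congr expR; rewrite !mulrA; congr (_ - _); rewrite mulrAC.
Qed.

Lemma ganelius_point_gt0 (R : realType) (r : R) (N k : nat) : (k <= N)%N ->
  0 < ganelius_point r N k.
Proof.
move=> kN; rewrite /ganelius_point; set q := ganelius_N0 r N.
case: leqP => [_|qk]; first by rewrite divr_gt0 ?expR_gt0.
case: eqP => [_|/eqP kq]; first by rewrite divr_gt0 ?expR_gt0.
have q2 : (q.+1 < k)%N by rewrite ltn_neqAle eq_sym kq.
have kR : k%:R <= N%:R :> R by rewrite ler_nat.
have qR : q%:R + 1 < k%:R :> R by rewrite natr1 ltr_nat.
rewrite subr_gt0 ltr_pdivrMr; lra.
Qed.

Lemma extra_point_bounds (R : realType) (r : R) (N k : nat) :
  (ganelius_N0 r N + 2 <= k <= N)%N -> 4 / 5 <= ganelius_point r N k <= 1.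
Proof.
rewrite /ganelius_point; set q := ganelius_N0 r N => /andP[qk kN].
have -> : (k <= q)%N = false by lia.
have -> : (k == q.+1) = false by lia.
have kR : k%:R <= N%:R :> R by rewrite ler_nat.
have qR : q%:R + 2 <= k%:R :> R by rewrite -natrD ler_nat.
have x0 : 0 <= (k%:R - q%:R - 1) / (5 * (N%:R - q%:R - 1)) :> R.
  by rewrite divr_ge0; lra.
have x1 : (k%:R - q%:R - 1) / (5 * (N%:R - q%:R - 1)) <= 1 / 5 :> R.
  rewrite ler_pdivrMr; lra.
by apply/andP; split; lra.
Qed.

Lemma exists_node_interval (R : realType) (c t : R) (q : nat) : (0 < q)%N ->
  0 <= t <= node c q%:R ->
  exists2 m, (m < q)%N & node c m%:R <= t <= node c m.+1%:R.
Proof.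
elim: q => // q IH _ /andP[t0 tq].
have [h|h] := leP (node c q%:R) t; first by exists q => //; rewrite h.
case: q IH tq h => [|q] IH tq h.
  by move: h; rewrite /node sqrtr0 mulr0; lra.
have [//||m mq mt] := IH; first by rewrite t0 ltW.
by exists m => //; exact: ltnW.
Qed.

Lemma exists_node_ge1 (R : realType) (c : R) : 0 < c ->
  exists K : nat, 1 <= node c K%:R.
Proof.
move=> c0; exists (Num.bound (c ^- 2)).
have ci : 0 <= c^-1 by rewrite invr_ge0 ltW.
rewrite /node mulrC -ler_pdivrMr// mul1r -[leLHS]ger0_norm// -sqrtr_sqr exprVn ler_wsqrtr//.
by rewrite ltW//; apply: archi_boundP; rewrite invr_ge0 sqr_ge0.
Qed.

Lemma sqrt_le_pow2 (R : realType) (q : nat) : Num.sqrt q%:R <= 2 ^+ q :> R.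
Proof.
have h : q%:R <= 2 ^+ q :> R by rewrite -natrX ler_nat ltnW// ltn_expl.
apply: le_trans h; case: q => [|q]; first by rewrite sqrtr0.
have h1 : 1 <= Num.sqrt q.+1%:R :> R by rewrite -[leLHS]sqrtr1 ler_wsqrtr// ler1n.
rewrite -[leRHS]sqr_sqrtr ?ler0n//; nra.
Qed.

Lemma ganelius_N0_sub (R : realType) (r : R) (N : nat) : (0 < ganelius_N0 r N)%N ->
  (ganelius_N0 r N)%:R + pi / 4 * Num.sqrt (N%:R * r) <= N%:R
    <= (ganelius_N0 r N)%:R + pi / 4 * Num.sqrt (N%:R * r) + 1.
Proof.
rewrite /ganelius_N0; set x := pi / 4 * _ => q0.
have x0 : 0 <= x by rewrite mulr_ge0 ?sqrtr_ge0// divr_ge0 ?pi_ge0.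
(* Since N_0 is positive, the truncated subtraction is a true one. *)
rewrite natrB; last by lia.
rewrite natr_absz ger0_norm; last by rewrite ceil_ge0 (lt_le_trans _ x0)// ltrN10.
have /andP[] := ceil_itv x; rewrite /x; lra.
Qed.

(** * Assembly of the exponent *)

Lemma ganelius_prod_split (R : realType) (r : R) (N : nat) (F : R -> R) :
  let q := ganelius_N0 r N in (q < N)%N ->
  \prod_(1 <= k < N.+1) F (ganelius_point r N k) =
  (\prod_(0 <= k < q) F (ganelius_phi r k%:R / ganelius_phi r q%:R)) *
  F (ganelius_phi r (q%:R - 1 / 2) / ganelius_phi r q%:R) *
  \prod_(q + 2 <= k < N.+1) F (ganelius_point r N k).
Proof.
rewrite /=; set q := ganelius_N0 r N => qN.
rewrite (@big_cat_nat _ _ _ q.+1)//=; last by lia.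
rewrite big_add1/= [X in _ * X]big_ltn; last by lia.
rewrite mulrA addn2; congr (_ * _ * _).
  apply: eq_big_nat => k /andP[_ kq]; rewrite /ganelius_point -/q kq.
  by congr (F (ganelius_phi r _ / _)); rewrite -natr1; ring.
by rewrite /ganelius_point -/q ltnn eqxx.
Qed.

(** Here P = pi, A = sqrt(N r), B = sqrt(N_0 r), [sigma] and [chi] are the order 2 series at 1 and
    at s, e = 2^-q, and [ne] counts the points after the first N_0 + 1. The growth r t cancels
    against [sigma] up to r t e <= r c; the truncation deficit 4 P B chi / P^2 cancels against the
    extra factors up to 16 chi / P^2 <= 2, whence 34 = 32 + 2; there remains - r T = - P B. *)
Lemma exponent_le (R : realFieldType) (r P c t T nK sigma chi e A B ne : R) :
  0 < r -> 0 < P -> 0 < c -> 0 <= nK -> r * c ^+ 2 = P ^+ 2 -> r * T = P * B -> B <= A ->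
  P ^+ 2 / 8 * (1 - e) <= sigma <= P ^+ 2 / 8 -> 0 <= chi <= P ^+ 2 / 8 ->
  0 <= t -> t * e <= c -> P / 4 * A - 1 <= ne ->
  r * (t - T) - ((8 * t - 4 * nK - 4) / c ^+ 2 * sigma - 4 * T / c ^+ 2 * chi - 32)
    - ne * (16 / P ^+ 2 * chi) <=
  (nK + 1) * r / 2 + r * c + 34 - P * B.
Proof.
move=> r0 P0 c0 nK0 rc rT BA /andP[sl su] /andP[chi0 chi1] t0 te neA.
have P2 : 0 < P ^+ 2 by rewrite exprn_gt0.
(* Scaling [sigma] and [chi] by P^2 = r c^2 clears the denominators. *)
have [a aE] : exists a, sigma = P ^+ 2 * a.
  by exists (sigma / P ^+ 2); rewrite mulrCA divff ?mulr1// gt_eqF.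
have [b bE] : exists b, chi = P ^+ 2 * b.
  by exists (chi / P ^+ 2); rewrite mulrCA divff ?mulr1// gt_eqF.
have al : 1 - e <= 8 * a.
  have : P ^+ 2 * (1 - e) <= P ^+ 2 * (8 * a) by lra.
  by rewrite ler_pM2l.
have au : 8 * a <= 1.
  have : P ^+ 2 * (8 * a) <= P ^+ 2 * 1 by lra.
  by rewrite ler_pM2l.
have b0 : 0 <= b by move: chi0; rewrite bE pmulr_rge0.
have bu : 8 * b <= 1.
  have : P ^+ 2 * (8 * b) <= P ^+ 2 * 1 by lra.
  by rewrite ler_pM2l.
rewrite aE bE -rc [leLHS](_ : _ = r * t * (1 - 8 * a) + (4 * nK + 4) * r * a
    + 4 * (r * T) * b - r * T + 32 - 16 * ne * b); last first.
  by field; rewrite !gt_eqF.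
rewrite rT.
have h1 : r * t * (1 - 8 * a) <= r * c.
  rewrite -mulrA; apply: ler_wpM2l; first exact: ltW.
  by apply: le_trans te; apply: ler_wpM2l => //; lra.
have h2 : (4 * nK + 4) * r * a <= (nK + 1) * r / 2.
  have : 0 <= (nK + 1) * r by rewrite mulr_ge0 ?addr_ge0// ltW.
  nra.
have h3 : 4 * (P * B) * b <= 4 * (P * A) * b.
  by rewrite ler_wpM2r// ler_wpM2l// ler_wpM2l// ltW.
have h4 : (P / 4 * A - 1) * (16 * b) <= ne * (16 * b).
  by apply: ler_wpM2r => //; lra.
lra.
Qed.

(** Compare x (x - y) <= x^2 - y^2 = N - q with the assumed bound on N - q, for x = sqrt N and y =
    sqrt q. Passing from sqrt(N_0 r) to sqrt(N r) thus costs a factor independent of N. *)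
Lemma node_count_defect (R : realType) (r P : R) (N q : nat) : 0 < r -> 0 < P ->
  (0 < N)%N -> (q <= N)%N -> N%:R <= q%:R + P / 4 * Num.sqrt (N%:R * r) + 1 ->
  Num.sqrt (N%:R * r) - Num.sqrt (q%:R * r) <= Num.sqrt r * (P / 4 * Num.sqrt r + 1).
Proof.
move=> r0 P0 N0 qN; rewrite !sqrtrM ?ler0n//.
set x : R := Num.sqrt N%:R; set y : R := Num.sqrt q%:R; set z := Num.sqrt r => h.
have z0 : 0 <= z by exact: sqrtr_ge0.
have y0 : 0 <= y by exact: sqrtr_ge0.
have x1 : 1 <= x by rewrite -[leLHS]sqrtr1 ler_wsqrtr// ler1n.
have yx : y <= x by rewrite ler_wsqrtr// ler_nat.
have xE : N%:R = x ^+ 2 by rewrite sqr_sqrtr ?ler0n.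
have yE : q%:R = y ^+ 2 by rewrite sqr_sqrtr ?ler0n.
rewrite -mulrBl mulrC; apply: ler_wpM2l => //.
have : x * (x - y) <= x * (P / 4 * z + 1) by rewrite xE yE in h; nra.
by rewrite ler_pM2l//; lra.
Qed.

Lemma extra_product_le (R : realType) (r s : R) (N n : nat) :
  0 <= s <= 1 -> (ganelius_N0 r N < N)%N ->
  \prod_((ganelius_N0 r N + 2)%N <= k < N.+1)
    `|(s - ganelius_point r N k) / (s + ganelius_point r N k)| <=
  expR (- ((N - (ganelius_N0 r N).+1)%:R * (16 / pi ^+ 2 * odd_series 2 (2 ^ n) s))).
Proof.
move=> s01 qN.
rewrite -mulrN expRM_natl.
have -> : (N - (ganelius_N0 r N).+1 = N.+1 - (ganelius_N0 r N + 2))%N.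
  by rewrite addn2 subSS.
rewrite -prodr_const_nat big_nat [leRHS]big_nat.
apply: ler_prod => k kb; rewrite normr_ge0/=.
by apply: extra_factor_le => //; apply: extra_point_bounds; rewrite -ltnS.
Qed.

Lemma weighted_product_le (R : realType) (r s : R) (N K : nat) :
  0 < r -> (0 < N)%N -> (0 < ganelius_N0 r N)%N ->
  let c := pi / Num.sqrt r in 1 <= node c K%:R -> 0 < s -> s <= 1 ->
  ganelius_weighted_product r N s <=
  expR ((node c K%:R + 1) * r / 2 + r * c + 34
        + pi * (Num.sqrt r * (pi / 4 * Num.sqrt r + 1)))
  * expR (- (pi * Num.sqrt (N%:R * r))).
Proof.
move=> r0 N0 q0; rewrite /=; set c := pi / Num.sqrt r => K1 s0 s1.
set q := ganelius_N0 r N in q0 *.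
have pi0 := @pi_gt0 R.
have sr0 : 0 < Num.sqrt r by rewrite sqrtr_gt0.
have c0 : 0 < c by rewrite divr_gt0.
have sN0 : 0 < Num.sqrt (N%:R * r) by rewrite sqrtr_gt0 mulr_gt0// ltr0n.
have /andP[Nlo Nhi] := ganelius_N0_sub q0; rewrite -/q in Nlo Nhi.
have qN : (q < N)%N.
  have : 0 < pi / 4 * Num.sqrt (N%:R * r) by rewrite mulr_gt0// divr_gt0.
  by rewrite -(ltr_nat R); lra.
have := node_count_defect r0 pi0 N0 (ltnW qN) Nhi.
set A := Num.sqrt (N%:R * r); set B := Num.sqrt (q%:R * r) => defect.
have pdefect : pi * (A - B) <= pi * (Num.sqrt r * (pi / 4 * Num.sqrt r + 1)).
  by apply: ler_wpM2l => //; exact: ltW.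
have BA : B <= A by apply: ler_wsqrtr; apply: ler_wpM2r; [exact: ltW|rewrite ler_nat ltnW].
set T := node c q%:R.
have T0 : 0 <= T by apply: node_ge0; exact: ltW.
have rE : r = Num.sqrt r ^+ 2 by rewrite sqr_sqrtr// ltW.
have cE : Num.sqrt r * c = pi by rewrite mulrCA divff ?mulr1// gt_eqF.
have rc : r * c ^+ 2 = pi ^+ 2 by rewrite [in LHS]rE -exprMn cE.
have rT : r * T = pi * B.
  by rewrite /B sqrtrM ?ler0n// /T /node -cE {1}rE; ring.
pose t := T + ln s.
have sE : s = expR (t - T) by rewrite /t addrC addKr lnK.
have tT : t <= T by rewrite /t gerDl ln_le0.
have powE : s `^ r = expR (r * (t - T)).
  by rewrite /powR gt_eqF// /t [T + _]addrC addrK.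
have prod_ge0 (m n : nat) : 0 <= \prod_(m <= k < n)
    `|(s - ganelius_point r N k) / (s + ganelius_point r N k)|.
  by apply: prodr_ge0.
rewrite /ganelius_weighted_product powE -expRD.
(* For t < 0 the point s lies below the least sampling point exp(- T); then s^r <= exp(- r T)
   already suffices, each factor being at most 1. *)
have [tneg|t0] := leP 0 t; last first.
  apply: (@le_trans _ _ (expR (r * (t - T)) * 1)).
    apply: ler_wpM2l; first exact: expR_ge0.
    rewrite big_nat; apply: prodr_ile1 => k /andP[_ kN].
    by rewrite normr_ge0 factor_le1 ?(ltW s0)// ganelius_point_gt0.
  rewrite mulr1 ler_expR.
  have : r * t <= 0 by rewrite pmulr_rle0// ltW.
  have : 0 <= (node c K%:R + 1) * r / 2 by rewrite divr_ge0// mulr_ge0 ?(ltW r0)//; lra.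
  have : 0 <= r * c by rewrite mulr_ge0// ltW.
  lra.
have tb : 0 <= t <= node c q%:R by rewrite tneg.
have [m mq mtm] := exists_node_interval q0 tb.
set chi := odd_series 2 (2 ^ q) s.
have phiE x : 0 <= x -> ganelius_phi r x / ganelius_phi r q%:R = expR (node c x - T).
  by move=> x0; rewrite phi_ratio// ler0n.
have q1 : 1 <= q%:R :> R by rewrite ler1n.
rewrite (ganelius_prod_split (fun a => `|(s - a) / (s + a)|))//=.
have nodes : (\prod_(0 <= k < q) `|(s - ganelius_phi r k%:R / ganelius_phi r q%:R) /
        (s + ganelius_phi r k%:R / ganelius_phi r q%:R)|) *
     `|(s - ganelius_phi r (q%:R - 1 / 2) / ganelius_phi r q%:R) /
        (s + ganelius_phi r (q%:R - 1 / 2) / ganelius_phi r q%:R)| <=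
   expR (- ((8 * t - 4 * node c K%:R - 4) / c ^+ 2 * odd_series 2 (2 ^ q) 1
    - 4 * T / c ^+ 2 * chi - 32)).
  rewrite /chi [in leRHS]sE; apply: le_trans (node_product_le _ c0 K1 mq mtm).
  rewrite phiE; last by lra.
  under eq_bigr do rewrite phiE ?ler0n//.
  by rewrite /node_factor -/T -sE.
have extras : \prod_(q + 2 <= k < N.+1)
    `|(s - ganelius_point r N k) / (s + ganelius_point r N k)| <=
   expR (- ((N - q.+1)%:R * (16 / pi ^+ 2 * chi))).
  by apply: extra_product_le => //; rewrite s1 ltW.
apply: (@le_trans _ _ (expR (r * (t - T)) * (expR (- ((8 * t - 4 * node c K%:R - 4)
    / c ^+ 2 * odd_series 2 (2 ^ q) 1 - 4 * T / c ^+ 2 * chi - 32)) *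
    expR (- ((N - q.+1)%:R * (16 / pi ^+ 2 * chi)))))).
  apply: ler_wpM2l; first exact: expR_ge0.
  by apply: ler_pM => //; rewrite mulr_ge0// prodr_ge0.
rewrite -!expRD ler_expR addrA.
have sb := odd_basel_bounds R q.
have cb : 0 <= chi <= pi ^+ 2 / 8.
  rewrite odd_series_ge0 ?(ltW s0)//=; have /andP[_] := sb; apply: le_trans.
  by apply: le_odd_series => //; exact: ltW.
(* This is what dictates 2^q terms in the series: t is at most c sqrt q. *)
have te : t * 2 ^- q <= c.
  rewrite ler_pdivrMr ?exprn_gt0//; apply: (le_trans tT).
  by apply: ler_wpM2l; [exact: ltW|exact: sqrt_le_pow2].
have neA : pi / 4 * A - 1 <= (N - q.+1)%:R.
  by rewrite natrB// -[q.+1%:R]natr1 /A; lra.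
have nK0 : 0 <= node c K%:R by lra.
have := exponent_le r0 pi0 c0 nK0 rc rT BA sb cb tneg te neA.
lra.
Qed.

(** * Existence of the maximum *)

Lemma continuous_factor_prod (R : realType) (r : R) (N : nat) (s : R) : 0 <= s ->
  {for s, continuous (fun x => \prod_(1 <= k < N.+1)
     `|(x - ganelius_point r N k) / (x + ganelius_point r N k)|)}.
Proof.
move=> s0.
pose F x (k : nat) := `|(x - ganelius_point r N k) / (x + ganelius_point r N k)|.
(* Recording the range of [k] as a predicate gives access to k <= N, hence to positive points and
   nonzero denominators. *)
rewrite (_ : (fun x => _) =
  (fun x => \prod_(1 <= k < N.+1 | (0 < k < N.+1)%N) F x k)); last first.
  by apply/funext => x; rewrite big_nat.
apply: cvg_big => [|k /andP[_]]; first exact: mul_continuous.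
rewrite ltnS => kN.
have a0 := ganelius_point_gt0 r kN.
have sa : 0 < s + ganelius_point r N k by lra.
apply: cvg_norm; apply: cvgM; first by apply: cvgB; [exact: cvg_id|exact: cvg_cst].
apply: cvgV; first exact: lt0r_neq0.
by apply: cvgD; [exact: cvg_id|exact: cvg_cst].
Qed.

Lemma weighted_product_max (R : realType) (r : R) (N : nat) : 0 < r ->
  exists2 s, 0 <= s <= 1 & forall x, 0 <= x <= 1 ->
    ganelius_weighted_product r N x <= ganelius_weighted_product r N s.
Proof.
move=> r0.
have cont x : 0 < x -> {for x, continuous (ganelius_weighted_product r N)}.
  move=> x0; apply: cvgM; last by apply: continuous_factor_prod; exact: ltW.
  have : derivable (fun y : R => y `^ r) x 1 by apply: derivable_powR; rewrite in_itv/= x0.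
  by move=> /derivable1_diffP/differentiable_continuous.
have [|s s01 smax] := @EVT_max R (ganelius_weighted_product r N) 0 1 ler01.
  apply/(continuous_within_itvP _ ltr01); split.
  - by move=> x /[!in_itv]/= /andP[x0 _]; exact: cont.
  (* At the endpoint 0 the power tends to 0 = 0^r because r > 0, and the product is continuous
     there. *)
  - rewrite /ganelius_weighted_product powR0 ?gt_eqF//.
    apply: cvgM; first exact: powR_cvg0.
    by apply: cvg_at_right_filter; exact: continuous_factor_prod.
  - by apply: cvg_at_left_filter; apply: cont.
exists s; first by rewrite in_itv in s01.
by move=> x x01; apply: smax; rewrite in_itv.
Qed.

Unset Implicit Arguments.

Theorem theorem4p2 (R : realType) (r : R) (r_gt0 : 0 < r) :
  exists2 C : R, 0 < C &
    forall N : nat, (0 < N)%N -> (1 <= ganelius_N0 r N)%N ->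
      exists2 M : R,
        is_maximum [set ganelius_weighted_product r N s | s in `[0, 1]] M &
        M <= C * expR (- (pi * Num.sqrt (N%:R * r))).
Proof.
set c := pi / Num.sqrt r.
have c0 : 0 < c by rewrite divr_gt0 ?pi_gt0// sqrtr_gt0.
have [K K1] := exists_node_ge1 c0.
exists (expR ((node c K%:R + 1) * r / 2 + r * c + 34
              + pi * (Num.sqrt r * (pi / 4 * Num.sqrt r + 1)))).
  exact: expR_gt0.
move=> N N_gt0 N0_gt0.
have [s /andP[s0 s1] smax] := weighted_product_max N r_gt0.
exists (ganelius_weighted_product r N s).
  split; first by exists s => //=; rewrite in_itv/= s0.
  by move=> _ [x /= x01 <-]; apply: smax; rewrite in_itv in x01.
(* The estimate uses ln s, so a maximum attained at s = 0, where the value is 0, is treated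
   apart. *)
move: s0; rewrite le_eqVlt => /predU1P[<-|s_gt0].
  rewrite /ganelius_weighted_product powR0 ?gt_eqF// mul0r.
  by rewrite mulr_ge0 ?expR_ge0.
exact: weighted_product_le.
Qed.
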